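(* Let $\eta_1,\dots,\eta_r$ be an integral basis of $\Lambda^\vee$, let $F=\sum_{\beta\in\mathcal S}N_\beta\Phi_\beta$ be a BPS resummed potential, and let $\mathbf H(\lambda,q)=(\nabla_{\eta_i}\nabla_{\eta_j}F)_{1\le i,j\le r}$. For $u_k=e^{ik\lambda/2}$ one has $$\mathbf H(\lambda,q)=-\sum_{\beta\in\mathcal S}N_\beta\sum_{k\ge1}\mathbf w_\beta(u_k)\,\mathbf w_\beta(u_k)^T\,\frac{q^{k\beta}}{k}.$$ In particular, if $\beta$ is primitive, then $$-[q^\beta]\mathbf H=N_\beta\,\mathbf w_\beta(u)\,\mathbf w_\beta(u)^T,\qquad u=e^{i\lambda/2},$$ so every primitive coefficient matrix has rank one. In the classical limit, for primitive $\beta$, $$-[q^\beta]\mathbf H^{\rm cl}=N_\beta\,\mathbf v_\beta\mathbf v_\beta^T,\qquad \mathbf v_\beta=(\langle\beta,\eta_i\rangle)_i .$$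
   Context: $\Lambda$ is a free abelian group of rank $r$ (the curve class lattice), $\Lambda^\vee=\operatorname{Hom}(\Lambda,\mathbb Z)$, and $\langle\cdot,\cdot\rangle$ is the pairing between them. A pointed effective monoid $\Lambda_+\subset\Lambda$ is fixed. All series in the Novikov variables $q^\beta=e^{2\pi i\langle\beta,t\rangle}$ are understood in the completion of the group algebra with respect to $\Lambda_+$, where the Kähler variable $t$ is taken on its universal cover. $[q^\beta]$ denotes the coefficient of $q^\beta$, taken entrywise for matrices. For an effective curve class $\beta$, $$\Phi_\beta(\lambda,t)=\sum_{k\ge1}\frac{q^{k\beta}}{k(2\sin(k\lambda/2))^2}.$$ The BPS resummed potential is $$F(\lambda,t)=\sum_{\beta\in\mathcal S}N_\beta\,\Phi_\beta(\lambda,t),$$ where $\mathcal S$ is the set of effective curve classes indexing the contribution and $N_\beta$ denotes the genus zero BPS multiplicity of $\beta$. For $\eta\in\Lambda^\vee$ and $h=\lambda/(2\pi)$, the half step translations act coefficientwise by $T_{\pm h\eta/2}\,q^\beta=e^{\pm i\lambda\langle\beta,\eta\rangle/2}q^\beta$, and $\nabla_\eta=T_{h\eta/2}-T_{-h\eta/2}$. For $m\in\mathbb Z$, $[m]_u=\frac{u^m-u^{-m}}{u-u^{-1}}$ is the signed $q$-integer, understood as a Laurent polynomial in $u$. For a curve class $\beta$, $\mathbf w_\beta(u)=([\langle\beta,\eta_i\rangle]_u)_i$ and $\mathbf v_\beta=(\langle\beta,\eta_i\rangle)_i$ are column vectors of length $r$. The classical limit is $\mathbf H^{\rm cl}=\mathbf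 H|_{\lambda=0}$. Primitive means primitive in the lattice $\Lambda$.
   Formalization: The claim that a primitive coefficient matrix has rank one is stated for primitive β in S with N_β ≠ 0, since for N_β = 0 the coefficient is the zero matrix. *)

(* Defs.v *)
From HB Require Import structures.
From mathcomp Require Import all_boot all_order all_algebra.
From mathcomp Require Import complex.
From mathcomp Require Import all_classical all_reals all_analysis.

Set Implicit Arguments.
Unset Strict Implicit.
Unset Printing Implicit Defensive.

Import Order.TTheory GRing.Theory Num.Theory.
Import numFieldNormedType.Exports.

Local Open Scope classical_set_scope.
Local Open Scope ring_scope.
Local Open Scope complex_scope.

Section Lattice.
Variables (L : zmodType) (r : nat).

Definition zbasis (e : 'I_r -> L) : Prop :=
  forall x : L, exists! c : {ffun 'I_r -> int}, x = \sum_i e i *~ c i.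

Definition free_of_rank : Prop := exists e : 'I_r -> L, zbasis e.

(* The dual lattice is {additive L -> int}, and the pairing of b : L with
   eta : {additive L -> int} is the value eta b. *)
Definition dual_zbasis (eta : 'I_r -> {additive L -> int}) : Prop :=
  forall f : {additive L -> int}, exists! c : {ffun 'I_r -> int},
    forall x : L, f x = \sum_i c i * eta i x.

Definition pointed_monoid (P : set L) : Prop :=
  [/\ P 0, forall x y, P x -> P y -> P (x + y)
    & forall x, P x -> P (- x) -> x = 0].

Definition primitive (b : L) : Prop :=
  b != 0 /\ forall (c : L) (k : nat), b = c *+ k -> k = 1%N.

End Lattice.

Section ComplexFunctions.
Variable R : realType.

(* R[i] seen through its numFieldType structure, from which the library infers
   the topology. *)
Definition Cplx : numFieldType := R[i].

Definition imag : Cplx := 0 +i* 1.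

Definition cexp (z : Cplx) : Cplx :=
  (expR (complex.Re z) * cos (complex.Im z))
  +i* (expR (complex.Re z) * sin (complex.Im z)).

Definition csin (z : Cplx) : Cplx :=
  (cexp (imag * z) - cexp (- (imag * z))) / (2 * imag).

End ComplexFunctions.

(* The value at u of the Laurent polynomial (X^m - X^-m) / (X - X^-1): for
   m = n > 0 this is X^(n-1) + X^(n-3) + ... + X^(1-n), and it is odd in m.
   See qintE; unlike the quotient, it takes the correct value at u = 1, -1. *)
Definition qint (K : fieldType) (m : int) (u : K) : K :=
  (sgz m)%:~R * \sum_(j < `|m|%N) u ^ (`|m|%:Z - 1 - (2 * j)%N%:Z).

Lemma qintE (K : fieldType) (m : int) (u : K) :
  u != 0 -> qint m u * (u - u^-1) = u ^ m - u ^ (- m).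
Proof.
move=> u0.
have uU : u \is a GRing.unit by rewrite unitfE.
have nat_case (n : nat) :
    (\sum_(j < n) u ^ (n%:Z - 1 - (2 * j)%N%:Z)) * (u - u^-1)
    = u ^ n%:Z - u ^ (- n%:Z).
  rewrite mulr_suml.
  under eq_bigr => j _.
    rewrite mulrBr -{2}(expr1z u) -(exprN1 u) -!expfzDr //.
    have -> : n%:Z - 1 - (2 * j)%N%:Z + 1 = n%:Z - (2 * j)%N%:Z.
      by rewrite addrAC subrK.
    have -> : n%:Z - 1 - (2 * j)%N%:Z - 1 = n%:Z - (2 * j.+1)%N%:Z.
      by rewrite mulnS addnC PoszD -!addrA -!opprD addrCA.
    over.
  rewrite -(big_mkord xpredT (fun j => u ^ (n%:Z - (2 * j)%N%:Z)
     - u ^ (n%:Z - (2 * j.+1)%N%:Z))).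
  under eq_bigr => j _ do rewrite -opprB.
  rewrite sumrN telescope_sumr // opprB muln0 subr0; congr (_ - u ^ _).
  by rewrite mul2n -addnn PoszD opprD addrA subrr add0r.
rewrite /qint; case: m => n.
  case: n => [|n]; last by rewrite /= mul1r nat_case.
  by rewrite big_ord0 mulr0 mul0r oppr0 subrr.
rewrite NegzE sgzN abszN absz_nat -mulrA nat_case /=.
by rewrite mulN1r opprB opprK.
Qed.

(* A formal series in the Novikov variables with coefficients in V is its
   coefficient function f : L -> V; [q^b] f is the value f b. Infinite sums of
   series are coefficientwise and make sense for locally finite families. *)
Section FormalSeries.
Variables (L : zmodType) (V : zmodType).

Definition in_completion (P : set L) (f : L -> V) : Prop :=
  forall b, f b != 0 -> P b.

Definition qmonomial (v : V) (b : L) : L -> V :=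
  fun c => if c == b then v else 0.

Definition locally_finite (I : choiceType) (D : set I) (f : I -> L -> V) :=
  forall b, finite_set [set i | D i /\ f i b != 0].

Definition formal_sum (I : choiceType) (D : set I) (f : I -> L -> V) : L -> V :=
  fun b => \sum_(i \in D) f i b.

End FormalSeries.

Section Potential.
Variables (R : realType) (L : zmodType).
Local Notation C := (Cplx R).

Definition Phi_term (b : L) (lambda : C) (k : nat) : L -> C :=
  qmonomial (k%:R * (2 * csin (k%:R * lambda / 2)) ^+ 2)^-1 (b *+ k).

Definition Phi (b : L) (lambda : C) : L -> C :=
  formal_sum [set k : nat | (0 < k)%N] (Phi_term b lambda).

Definition potential_term (N : L -> int) (lambda : C) (b : L) : L -> C :=
  fun c => (N b)%:~R * Phi b lambda c.

Definition potential (S : set L) (N : L -> int) (lambda : C) : L -> C :=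
  formal_sum S (potential_term N lambda).

(* T_{h eta / 2} for e = 1 and T_{- h eta / 2} for e = -1, h = lambda / 2 pi *)
Definition half_step (e : int) (lambda : C) (eta : {additive L -> int})
    (f : L -> C) : L -> C :=
  fun b => cexp (imag R * (e * eta b)%:~R * lambda / 2) * f b.

Definition nabla (lambda : C) (eta : {additive L -> int}) (f : L -> C) : L -> C :=
  fun b => half_step 1 lambda eta f b - half_step (-1) lambda eta f b.

Variables (r : nat) (eta : 'I_r -> {additive L -> int}).

(* Away from the poles in lambda of the coefficients of the potential. *)
Definition hessian_off_poles (S : set L) (N : L -> int) (lambda : C) (b : L) :
    'M[C]_r :=
  \matrix_(i, j)
    nabla lambda (eta i) (nabla lambda (eta j) (potential S N lambda)) b.

(* The coefficients of H are meromorphic functions of lambda whose poles are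
   all removable; their value at any lambda, including lambda = 0, is the limit
   along the punctured neighborhoods of lambda. *)
Definition hessian (S : set L) (N : L -> int) (lambda : C) (b : L) : 'M[C]_r :=
  \matrix_(i, j) lim (hessian_off_poles S N mu b i j @[mu --> lambda^']).

Definition classical_hessian (S : set L) (N : L -> int) : L -> 'M[C]_r :=
  hessian S N 0.

Definition regular_at (S : set L) (lambda : C) (c : L) : Prop :=
  forall (b : L) (k : nat), S b -> (0 < k)%N -> b *+ k = c ->
    csin (k%:R * lambda / 2) != 0.

Definition w_vec (b : L) (u : C) : 'cV[C]_r := \col_i qint (eta i b) u.

Definition v_vec (b : L) : 'cV[C]_r := \col_i (eta i b)%:~R.

Definition u_ (k : nat) (lambda : C) : C := cexp (imag R * k%:R * lambda / 2).

Definition resummed_inner_term (lambda : C) (b : L) (k : nat) : L -> 'M[C]_r :=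
  qmonomial (k%:R^-1 *: (w_vec b (u_ k lambda) *m (w_vec b (u_ k lambda))^T))
    (b *+ k).

Definition resummed_term (N : L -> int) (lambda : C) (b : L) : L -> 'M[C]_r :=
  fun c => (N b)%:~R *:
    formal_sum [set k : nat | (0 < k)%N] (resummed_inner_term lambda b) c.

End Potential.

(* Main.v *)
Require Import Defs.
From HB Require Import structures.
From mathcomp Require Import all_boot all_order all_algebra.
From mathcomp Require Import complex.
From mathcomp Require Import all_classical all_reals all_analysis.
From mathcomp Require Import ring.

(** The half steps act on q^c by scalars, so nabla_eta multiplies the
coefficient of q^c by e^{i lambda <c,eta>/2} - e^{-i lambda <c,eta>/2}. For
c = k b this symbol is u_k^m - u_k^-m with m = <b,eta>, that is
[m]_{u_k} (u_k - u_k^-1) ([nabla_symbolMn]). On the other side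
(2 sin(k lambda/2))^2 equals - (u_k - u_k^-1)^2 ([csin_sqr_u]). Hence two nablas
cancel the denominator of the k-th term of Phi_b and leave
- [m_i]_{u_k} [m_j]_{u_k} / k, as long as that denominator does not vanish
([nabla_nabla_Phi_term]).

Three points remain.

Finiteness. An integral basis of the dual lattice detects divisibility in the
lattice ([dual_zbasis_divisible]): divisibility by 0 gives the injectivity of
b |-> (<b,eta_i>)_i, hence torsion freeness, and the absolute value of a nonzero
<c,eta_i> bounds the k with c = k b. So each c is k b for finitely many pairs
(b, k) with b in S ([divisor_support]), and every coefficient is a finite sum
over two fixed sequences of classes and multiplicities, independent of lambda.

Poles. sin(k mu/2) vanishes iff e^{i k mu} = 1, and 1 is an isolated value of
the exponential: it is taken at 0 only in the unit disc, hence on a discrete set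
([cexp_neq1_near]). So for each c the resummed formula holds on a punctured
neighbourhood of every lambda. Its right hand side is a Laurent polynomial in
values of the exponential, hence continuous, so it is also the value of the
Hessian, defined as a limit, at lambda itself ([hessianE]).

Rank. For primitive b only the pair (b, 1) contributes to q^b, which gives
N_b w w^T. If N_b is nonzero, its rank is one because w does not vanish ([w_vec_neq0]):
where u^2 = 1, [m]_u is m up to sign; elsewhere [m]_u = 0 says that the order of
u^2 divides m, and an integer greater than 1 cannot divide all the <b,eta_i>. *)

Set Implicit Arguments.
Unset Strict Implicit.
Unset Printing Implicit Defensive.

Import Order.TTheory GRing.Theory Num.Theory.
Import numFieldNormedType.Exports.

Local Open Scope classical_set_scope.
Local Open Scope ring_scope.

(** * The complex exponential *)

Lemma continuous_mulf (K : numFieldType) (f g : K -> K) :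
  continuous f -> continuous g -> continuous (fun x => f x * g x).
Proof. by move=> cf cg x; exact: (cvgM (cf x) (cg x)). Qed.

Lemma continuous_sumf (K : numFieldType) (I : Type) (s : seq I)
    (f : I -> K -> K) :
  (forall i, continuous (f i)) -> continuous (fun x => \sum_(i <- s) f i x).
Proof.
move=> cf; apply: (@continuous_big K I +%R 0 xpredT) => [|i _]; last exact: cf.
exact: add_continuous.
Qed.

Section ComplexExponential.
Variable R : realType.
Local Notation C := (Cplx R).
Implicit Types z w : C.

Lemma cexpD z w : cexp (z + w) = cexp z * cexp w.
Proof.
case: z w => [a b] [c d]; rewrite /cexp /= expRD cosD sinD.
by apply/eqP; rewrite eq_complex /=; apply/andP; split; apply/eqP; ring.
Qed.

Lemma cexp0 : cexp (0 : C) = 1.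
Proof. by rewrite /cexp /= expR0 cos0 sin0 mulr1 mulr0. Qed.

Lemma cexp_neq0 z : cexp z != 0.
Proof.
apply/eqP => z0; have := cexpD z (- z).
by rewrite subrr cexp0 z0 mul0r => /eqP; rewrite oner_eq0.
Qed.

Lemma cexpN z : cexp (- z) = (cexp z)^-1.
Proof.
by apply: (mulfI (cexp_neq0 z)); rewrite -cexpD subrr cexp0 mulfV ?cexp_neq0.
Qed.

Lemma cexp_mulz z (m : int) : cexp (z * m%:~R) = cexp z ^ m.
Proof.
have nat_case (n : nat) : cexp (z * n%:R) = cexp z ^+ n.
  elim: n => [|n IHn]; first by rewrite mulr0 cexp0 expr0.
  by rewrite -natr1 mulrDr mulr1 cexpD IHn exprSr.
case: m => n; first exact: nat_case.
by rewrite NegzE mulrNz mulrN cexpN nat_case exprnN.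
Qed.

Lemma near_dist_lt (z e : C) : 0 < e -> \forall w \near z, `|z - w| < e.
Proof. by move=> e0; exists e. Qed.

Lemma continuous_complexRe : continuous (@complex.Re R : C -> R).
Proof.
move=> z; apply/(@cvgrPdist_lt _ R^o _ (nbhs z)) => e e0.
have : \forall w \near z, `|z - w| < (e%:C)%C :> C.
  by apply: near_dist_lt; rewrite ltcR.
apply: filterS => w zw; rewrite -ltcR; apply: le_lt_trans zw.
by have := normc_ge_Re (z - w); case: (z) (w) => [? ?] [].
Qed.

Lemma continuous_complexIm : continuous (@complex.Im R : C -> R).
Proof.
move=> z; apply/(@cvgrPdist_lt _ R^o _ (nbhs z)) => e e0.
have : \forall w \near z, `|z - w| < (e%:C)%C :> C.
  by apply: near_dist_lt; rewrite ltcR.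
apply: filterS => w zw; rewrite -ltcR; apply: le_lt_trans zw.
have := normc_ge_Re (- (imag R * (z - w))).
rewrite normrN normrM [`|imag R|]normc_def /= expr0n expr1n add0r sqrtr1 mul1r.
apply: le_trans; case: (z) (w) => [? ?] [? ?] /=.
rewrite lecR !(mul0r, mul1r, add0r, sub0r, opprK). exact: lexx.
Qed.

(** Distances in the complex numbers are themselves complex numbers, so the
radius e + i I is positive when I = 0 and e is positive. *)
Lemma continuous_real_complex : continuous (real_complex R : R -> C).
Proof.
move=> x; apply/(@cvgrPdist_lt _ C^o _ (nbhs x)) => e.
case: e => e i; rewrite ltcE /= => /andP[i0 e0].
near=> y.
rewrite -rmorphB normc_def /= expr0n addr0 sqrtr_sqr ltcE /= i0 /=.
by near: y; apply: cvgr_dist_lt => //; exact: cvg_id.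
Unshelve. all: by end_near. Qed.

Lemma continuous_cexp : continuous (@cexp R).
Proof.
pose rc (x : R) : C := x%:C%C.
have cexpE : @cexp R = (fun z : C => rc (expR (complex.Re z)) *
    (rc (cos (complex.Im z)) + imag R * rc (sin (complex.Im z)))).
  apply/funext => z; apply/eqP; rewrite eq_complex /=.
  by apply/andP; split; apply/eqP; ring.
have lift (f : R -> R) (g : C -> R) z : continuous f -> continuous g ->
    rc (f (g w)) @[w --> z] --> rc (f (g z)).
  move=> cf cg; apply: (@cvg_comp _ _ _ (f \o g) rc); last first.
    exact: continuous_real_complex.
  exact: (@cvg_comp _ _ _ g f _ _ _ (cg z) (cf (g z))).
move=> z; rewrite cexpE.
have cvg_exp := lift _ _ z (@continuous_expR R) continuous_complexRe.
have cvg_cos := lift _ _ z (@continuous_cos R) continuous_complexIm.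
have cvg_sin := lift _ _ z (@continuous_sin R) continuous_complexIm.
exact: (cvgM cvg_exp (cvgD cvg_cos (cvgM (cvg_cst (imag R)) cvg_sin))).
Qed.

(** Since pi > 1, the imaginary part is a zero of the sine inside ]-pi, pi[,
hence zero; then the modulus of the exponential gives the real part. *)
Lemma cexp_eq1_small (z : C) : `|z| < 1 -> cexp z = 1 -> z = 0.
Proof.
case: z => a b z1 /eqP; rewrite eq_complex /= => /andP[/eqP ab1 /eqP ab0].
have b1 : `|b| < 1.
  rewrite -ltcR; apply: le_lt_trans z1; rewrite normc_def lecR /=.
  by rewrite -(sqrtr_sqr b) ler_sqrt ?addr_ge0 ?sqr_ge0 // lerDr sqr_ge0.
have /eqP := ab0; rewrite mulf_eq0 gt_eqF ?expR_gt0 //= => /eqP sb0.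
have {sb0} b0 : b = 0.
  have pi1 : 1 < pi :> R by apply: lt_le_trans (pi_ge2 _); rewrite ltr1n.
  have [b0|b0|//] := ltrgtP b 0.
    have : 0 < sin (- b).
      apply: sin_gt0_pi; rewrite oppr_gt0 b0 /= (lt_trans _ pi1) //.
      by rewrite -ltr0_norm.
    by rewrite sinN sb0 oppr0 ltxx.
  have : 0 < sin b.
    by apply: sin_gt0_pi; rewrite b0 /= (lt_trans _ pi1) // -(gtr0_norm b0).
  by rewrite sb0 ltxx.
move: ab1; rewrite b0 cos0 mulr1 -[X in _ = X]expR0 => /expR_inj ->.
by [].
Qed.

(** Where the exponential is not 1 this is continuity; where it is 1, the
addition formula moves the question to a punctured neighbourhood of 0. *)
Lemma cexp_neq1_near (w : C) : \forall z \near w^', cexp z != 1.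
Proof.
have [w1|w1] := eqVneq (cexp w) 1; last first.
  apply: nbhs_dnbhs.
  have cvg1 := cvgB (@continuous_cexp w) (cvg_cst (1 : C)).
  have := cvgr_neq0 _ (cvg1 _ _); rewrite subr_eq0 => /(_ _ _ _ w1).
  by apply: filterS => z; rewrite subr_eq0.
near=> z; apply/eqP => z1.
have zw : z != w by near: z; exact: nbhs_dnbhs_neq.
have d1 : `|z - w| < 1.
  rewrite distrC; near: z; apply: nbhs_dnbhs.
  exact: near_dist_lt.
move/eqP: zw; apply; apply/eqP; rewrite -subr_eq0; apply/eqP.
by apply: cexp_eq1_small => //; rewrite cexpD cexpN z1 w1 invr1 mulr1.
Unshelve. all: by end_near. Qed.

End ComplexExponential.

(** * Divisibility in a lattice and its dual *)

Section DualBasis.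
Variables (L : zmodType) (r : nat).

(** The coordinates of a lattice are integral functionals, which makes them
integral combinations of any basis of the dual. *)
Lemma additive_coordinates : free_of_rank L r ->
  exists (e : 'I_r -> L) (x : 'I_r -> {additive L -> int}),
    forall b, b = \sum_i e i *~ x i b.
Proof.
move=> [e e_basis].
have [c cP] := choice (fun b => e_basis b).
have c_sub i : zmod_morphism (fun b => c b i).
  move=> b b'; have [_ cU] := cP (b - b').
  rewrite (cU [ffun j => c b j - c b' j]) ?ffunE //.
  rewrite {1}(cP b).1 {1}(cP b').1 -sumrB; apply: eq_bigr => j _.
  by rewrite ffunE mulrzBr.
pose x i := HB.pack_for {additive L -> int} (fun b => c b i)
  (GRing.isZmodMorphism.Build _ _ _ (c_sub i)).
by exists e, x => b; exact: (cP b).1.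
Qed.

Variable eta : 'I_r -> {additive L -> int}.
Hypothesis hL : free_of_rank L r.
Hypothesis heta : dual_zbasis eta.

(** The coordinates of b are integral combinations of the eta_i b, so they are
divisible by d too. The case d = 0 says that the eta_i separate points. *)
Lemma dual_zbasis_divisible (b : L) (d : int) :
  (forall i, (d %| eta i b)%Z) -> exists c, b = c *~ d.
Proof.
move=> d_eta; have [e [x xP]] := additive_coordinates hL.
have d_x i : (d %| x i b)%Z.
  have [a [aP _]] := heta (x i).
  by rewrite aP; apply: rpred_sum => j _; rewrite dvdz_mull.
exists (\sum_i e i *~ (x i b %/ d)%Z); rewrite [LHS]xP mulrz_suml.
by apply: eq_bigr => i _; rewrite -mulrzA divzK.
Qed.

Lemma dual_zbasis_separates (b : L) : (forall i, eta i b = 0) -> b = 0.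
Proof.
move=> eta0; have [|c ->] := @dual_zbasis_divisible b 0; last by rewrite mulr0z.
by move=> i; rewrite eta0.
Qed.

Lemma torsion_free (b : L) (k : nat) : (0 < k)%N -> b *+ k = 0 -> b = 0.
Proof.
move=> k0 bk; apply: dual_zbasis_separates => i; apply/eqP.
have := raddfMn (eta i) k b; rewrite bk raddf0 => /esym/eqP.
by rewrite mulrn_eq0 gtn_eqF.
Qed.

Lemma mulrn_injl (b b' : L) (k : nat) : (0 < k)%N -> b *+ k = b' *+ k -> b = b'.
Proof.
move=> k0 bb'; apply/eqP; rewrite -subr_eq0; apply/eqP.
by apply: (torsion_free k0); rewrite mulrnBl bb' subrr.
Qed.

(** Some eta_i c is nonzero, and k divides it whenever c is a k-th multiple. *)
Lemma mulrn_bound (c : L) : c != 0 ->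
  exists M, forall b k, b *+ k = c -> (k <= M)%N.
Proof.
move=> c0; have [i ci] : exists i, eta i c != 0.
  apply/existsP; apply: contra_neqT c0 => /existsPn c_eta.
  apply: dual_zbasis_separates => i; apply/eqP.
  by have := c_eta i; rewrite negbK.
exists `|eta i c|%N => b k bk; move: ci; rewrite -bk raddfMn -mulr_natr abszM.
rewrite mulf_eq0 negb_or natz => /andP[b0 _].
by rewrite absz_nat leq_pmull // absz_gt0.
Qed.

Lemma primitive_dvd1 (b : L) (d : nat) : primitive b ->
  (forall i, (d%:Z %| eta i b)%Z) -> d = 1%N.
Proof. by move=> [_ bP] /dual_zbasis_divisible[c bc]; apply: (bP c). Qed.

(** The coefficient of q^c only sees the classes b in S and the k > 0 with
c = k b. They are collected in two lists independent of lambda; pairs from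
bs and ks with k b <> c are harmless, as their terms do not contribute. *)
Lemma divisor_support (S : set L) (c : L) : (forall b, S b -> b != 0) ->
  exists (bs : seq L) (ks : seq nat),
    [/\ uniq bs, uniq ks, {in bs, forall b, S b}, {in ks, forall k, (0 < k)%N}
      & forall b k, S b -> (0 < k)%N -> b *+ k = c -> b \in bs /\ k \in ks].
Proof.
move=> S0.
(* 0 is a positive multiple of no class of S. *)
have [->|c0] := eqVneq c 0.
  exists [::], [::]; split=> // b k Sb k0 /(torsion_free k0) b0.
  by have := S0 b Sb; rewrite b0 eqxx.
have [M leM] := mulrn_bound c0.
pose g k : L := xget 0 [set b | b *+ k = c].
pose A := S `&` [set b | exists2 k, (0 < k)%N & b *+ k = c].
have finA : finite_set A.
  apply: (@sub_finite_set _ _ (g @` `I_M.+1)).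
    2: exact/finite_image/finite_II.
  move=> b [_ [k k0 bk]]; exists k; first by rewrite /= ltnS (leM b).
  apply: (mulrn_injl k0); rewrite bk.
  by apply: (@xgetPex _ 0 [set b | b *+ k = c]); exists b.
exists (finmap.enum_fset (fset_set A)), (iota 1 M); split=> //.
- exact: finmap.fset_uniq.
- exact: iota_uniq.
- by move=> b; rewrite in_fset_set // inE => -[].
- by move=> k; rewrite mem_iota => /andP[].
move=> b k Sb k0 bk; rewrite in_fset_set // mem_iota k0 add1n ltnS (leM b) //.
by split=> //; rewrite inE; split=> //; exists k.
Qed.

End DualBasis.

(** * Finite sums of formal series *)

Lemma qmonomial_neq0 (L V : zmodType) (v : V) (b c : L) :
  qmonomial v b c != 0 -> c = b.
Proof. by rewrite /qmonomial; case: (c =P b) => // _; rewrite eqxx. Qed.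

Lemma formal_sum_seq (L V : zmodType) (I : choiceType) (D : set I)
    (f : I -> L -> V) (s : seq I) (c : L) :
  uniq s -> {in s, forall i, D i} -> (forall i, D i -> f i c != 0 -> i \in s) ->
  formal_sum D f c = \sum_(i <- s) f i c.
Proof.
move=> s_uniq sD Ds; rewrite fsbig_seq //; apply/esym/fsbig_widen.
  by move=> i /sD.
move=> i [Di /= /negP si]; apply/eqP; apply: contraNT si; exact: Ds.
Qed.

(** * Quantum integers at roots of unity *)

Section QIntegers.
Variables (K : numFieldType) (u : K).

(** Multiplying by u - 1/u shows that u^m = u^-m. *)
Lemma qint_root_of_unity (m : int) :
  u != 0 -> qint m u = 0 -> (u ^+ 2) ^+ `|m| = 1.
Proof.
move=> u0 m0; have := qintE m u0; rewrite m0 mul0r => /esym/eqP.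
rewrite subr_eq0 => /eqP um; have {um} : u ^ (2 * m) = 1.
  by rewrite mulrDl mul1r expfzDr // {1}um -expfzDr // addNr expr0z.
rewrite -exprM; case: m {m0} => n; first by [].
rewrite NegzE mulrN -exprnN => /eqP; rewrite invr_eq1 => /eqP.
by [].
Qed.

(** All the exponents of u in [m]_u have the same parity as m - 1. *)
Lemma qint_sqr1 (m : int) : u ^+ 2 = 1 -> qint m u = m%:~R * u ^ (`|m|%:Z - 1).
Proof.
move=> u2; have u0 : u != 0.
  apply/eqP => u0; move: u2; rewrite u0 expr0n => /esym/eqP.
  by rewrite oner_eq0.
rewrite /qint; under eq_bigr => j _.
  rewrite expfzDr // -exprnN exprM u2 expr1n invr1 mulr1.
  over.
rewrite sumr_const card_ord -mulr_natl mulrA; congr (_ * _).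
by rewrite {3}(intEsg m) intrM.
Qed.

End QIntegers.

(** * The resummed Hessian away from the poles *)

Section Hessian.
Variables (R : realType) (L : zmodType) (r : nat).
Local Notation C := (Cplx R).
Variable eta : 'I_r -> {additive L -> int}.

Lemma imag_sqr : imag R * imag R = -1.
Proof.
by apply/eqP; rewrite eq_complex /=; apply/andP; split; apply/eqP; ring.
Qed.

Lemma imag_neq0 : imag R != 0.
Proof. by rewrite eq_complex /= oner_eq0 andbF. Qed.

Lemma u_neq0 k (mu : C) : u_ k mu != 0. Proof. exact: cexp_neq0. Qed.

Lemma csin_u k (mu : C) :
  2 * csin (k%:R * mu / 2) = (u_ k mu - (u_ k mu)^-1) / imag R.
Proof.
rewrite /csin /u_ !mulrA cexpN; field.
by rewrite imag_neq0 cexp_neq0.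
Qed.

Lemma csin_sqr_u k (mu : C) :
  (2 * csin (k%:R * mu / 2)) ^+ 2 = - (u_ k mu - (u_ k mu)^-1) ^+ 2.
Proof.
by rewrite csin_u expr_div_n [imag R ^+ 2]expr2 imag_sqr invrN1 mulrN1.
Qed.

(** The sine vanishes at z only if exp(2iz) = 1; here 2iz = i k mu, and the
linear map mu |-> i k mu preserves punctured neighbourhoods. *)
Lemma csin_neq0_near k (lambda : C) : (0 < k)%N ->
  \forall mu \near lambda^', csin (k%:R * mu / 2) != 0.
Proof.
move=> k0; pose a : C := imag R * k%:R.
have a0 : a != 0 by rewrite mulf_neq0 ?imag_neq0 // pnatr_eq0 -lt0n.
have cvg_a : a * mu @[mu --> lambda^'] --> (a * lambda)^'.
  apply: continuous_injective_withinNx => [|mu]; last exact: (mulfI a0).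
  exact: mulrl_continuous.
have : \forall mu \near lambda^', cexp (a * mu) != 1.
  exact: cvg_a (cexp_neq1_near (a * lambda)).
apply: filterS => mu; apply: contra_neq => s0.
have /eqP := csin_u k mu; rewrite s0 mulr0 eq_sym mulf_eq0 invr_eq0.
rewrite (negPf imag_neq0) orbF subr_eq0 => /eqP uu.
have -> : a * mu = imag R * k%:R * mu / 2 + imag R * k%:R * mu / 2.
  by rewrite /a; field.
by rewrite cexpD -/(u_ k mu) {1}uu mulVf ?u_neq0.
Qed.

Definition nabla_symbol (mu : C) (e : {additive L -> int}) (c : L) : C :=
  cexp (imag R * (1 * e c)%:~R * mu / 2)
  - cexp (imag R * (-1 * e c)%:~R * mu / 2).

Lemma nablaE mu e (f : L -> C) c : nabla mu e f c = nabla_symbol mu e c * f c.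
Proof. by rewrite /nabla /half_step mulrBl. Qed.

Lemma nabla_symbolMn mu e b k :
  nabla_symbol mu e (b *+ k) = qint (e b) (u_ k mu) * (u_ k mu - (u_ k mu)^-1).
Proof.
rewrite qintE ?u_neq0 // /nabla_symbol /u_ -!cexp_mulz raddfMn.
rewrite mul1r mulN1r !mulrNz rmorphMn /= -(mulr_natr (e b)%:~R).
by congr (cexp _ - cexp _); ring.
Qed.

Lemma inner_term_entry lambda b k c i j :
  resummed_inner_term eta lambda b k c i j = if c == b *+ k then
    k%:R^-1 * (qint (eta i b) (u_ k lambda) * qint (eta j b) (u_ k lambda))
  else 0 :> C.
Proof.
rewrite /resummed_inner_term /qmonomial; case: ifP; rewrite !mxE //.
by rewrite big_ord1 !mxE.
Qed.

(** The two symbols contribute (u - 1/u)^2, where u = u_k, which cancels the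
squared sine of the denominator up to the sign. When q^c is not the monomial
of this term both sides vanish, whether or not mu is a pole. *)
Lemma nabla_nabla_Phi_term mu b k c i j :
  (b *+ k = c -> csin (k%:R * mu / 2) != 0) ->
  nabla_symbol mu (eta i) c * nabla_symbol mu (eta j) c * Phi_term b mu k c
  = - resummed_inner_term eta mu b k c i j.
Proof.
move=> s0; rewrite inner_term_entry /Phi_term /qmonomial.
case: eqP => [bk|_]; last by rewrite mulr0 oppr0.
have {}s0 := s0 (esym bk); rewrite {}bk.
rewrite !nabla_symbolMn csin_sqr_u.
have d0 : u_ k mu - (u_ k mu)^-1 != 0.
  apply: contra_neq s0 => d0; have /eqP := csin_u k mu.
  by rewrite d0 mul0r mulf_eq0 pnatr_eq0 => /eqP.
(* k%:R^-1 is generalized so that field does not ask for k to be nonzero. *)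
move: (_ - _) d0 => d d0; rewrite mulrN invrN invfM; move: (k%:R^-1) => t.
field.
exact: d0.
Qed.

Section Support.
Variables (S : set L) (N : L -> int) (c : L) (bs : seq L) (ks : seq nat).
Hypotheses (bs_uniq : uniq bs) (ks_uniq : uniq ks).
Hypotheses (bsS : {in bs, forall b, S b}) (ks0 : {in ks, forall k, (0 < k)%N}).
Hypothesis support : forall b k, S b -> (0 < k)%N -> b *+ k = c ->
  b \in bs /\ k \in ks.

(** Stated for any coefficients v, so as to apply both to the terms of Phi_b and
to the matrices of the resummed side. *)
Lemma formal_sum_multiples (V : zmodType) (v : nat -> V) b : S b ->
  formal_sum [set k : nat | (0 < k)%N] (fun k => qmonomial (v k) (b *+ k)) c
  = \sum_(k <- ks) qmonomial (v k) (b *+ k) c.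
Proof.
move=> Sb; apply: formal_sum_seq => // k k0.
move=> /qmonomial_neq0 ck.
exact: (support Sb k0 (esym ck)).2.
Qed.

Lemma formal_sum_multiples0 (V : zmodType) (v : nat -> V) b :
  S b -> b \notin bs ->
  formal_sum [set k : nat | (0 < k)%N] (fun k => qmonomial (v k) (b *+ k)) c
  = 0.
Proof.
move=> Sb bN; rewrite formal_sum_multiples // big_seq big1 // => k kks.
apply/eqP; apply: contraNT bN => /qmonomial_neq0 bk.
by have [] := support Sb (ks0 kks) (esym bk).
Qed.

Lemma potentialE (mu : C) : potential S N mu c =
  \sum_(b <- bs) (N b)%:~R * \sum_(k <- ks) Phi_term b mu k c.
Proof.
rewrite /potential (formal_sum_seq (s := bs)) //.
  rewrite !big_seq; apply: eq_bigr => b /bsS Sb; congr (_ * _).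
  exact: formal_sum_multiples.
move=> b Sb; apply: contraNT => bN.
by rewrite /potential_term /Phi formal_sum_multiples0 // mulr0.
Qed.

Lemma resummedE (mu : C) : formal_sum S (resummed_term eta N mu) c =
  \sum_(b <- bs) (N b)%:~R *: \sum_(k <- ks) resummed_inner_term eta mu b k c.
Proof.
rewrite (formal_sum_seq (s := bs)) //.
  rewrite !big_seq; apply: eq_bigr => b /bsS Sb; congr (_ *: _).
  exact: formal_sum_multiples.
move=> b Sb; apply: contraNT => bN.
by rewrite /resummed_term formal_sum_multiples0 // scaler0.
Qed.

Lemma off_polesE (mu : C) : regular_at S mu c ->
  hessian_off_poles eta S N mu c = - formal_sum S (resummed_term eta N mu) c.
Proof.
move=> c_regular; apply/matrixP => i j.
rewrite resummedE !mxE !nablaE mulrA potentialE mulr_sumr summxE -sumrN.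
rewrite !big_seq.
apply: eq_bigr => b /bsS Sb; rewrite mxE summxE -mulrN -sumrN mulrCA mulr_sumr.
congr (_ * _); rewrite !big_seq; apply: eq_bigr => k /ks0 k0.
by apply: nabla_nabla_Phi_term => /(c_regular b k Sb k0).
Qed.

End Support.

(** Powers of u_k, negative ones included, are exponentials of multiples of
mu, so this Laurent polynomial has no pole. *)
Lemma continuous_qint_u (m : int) k :
  continuous (fun mu : C => qint m (u_ k mu)).
Proof.
have continuous_pow (z : int) : continuous (fun mu : C => u_ k mu ^ z).
  have -> : (fun mu : C => u_ k mu ^ z)
          = @cexp R \o ( *%R (imag R * k%:R / 2 * z%:~R)).
    by apply/funext => mu /=; rewrite /u_ -cexp_mulz; congr cexp; ring.
  move=> mu; set a := (_ / 2 * _).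
  have cvg_a := @mulrl_continuous C a mu.
  exact: (@cvg_comp _ _ _ _ _ _ _ _ cvg_a (@continuous_cexp R (a * mu))).
apply: continuous_mulf; first exact: cst_continuous.
by apply: continuous_sumf => j; exact: continuous_pow.
Qed.

Lemma continuous_resummed (N : L -> int) (c : L) (bs : seq L) (ks : seq nat)
    i j :
  continuous (fun mu : C => (\sum_(b <- bs) (N b)%:~R *:
    \sum_(k <- ks) resummed_inner_term eta mu b k c) i j).
Proof.
rewrite (_ : (fun mu => _) = (fun mu : C => \sum_(b <- bs) (N b)%:~R *
    \sum_(k <- ks) resummed_inner_term eta mu b k c i j)); last first.
  apply/funext => mu; rewrite summxE; apply: eq_bigr => b _.
  by rewrite mxE summxE.
apply: continuous_sumf => b.
apply: continuous_mulf; first exact: cst_continuous.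
apply: continuous_sumf => k; have [ck|ck] := boolP (c == b *+ k).
  rewrite (_ : (fun mu => _) = (fun mu : C =>
    k%:R^-1 * (qint (eta i b) (u_ k mu) * qint (eta j b) (u_ k mu))));
    last first.
    by apply/funext => mu; rewrite inner_term_entry ck.
  apply: continuous_mulf; first exact: cst_continuous.
  by apply: continuous_mulf; exact: continuous_qint_u.
rewrite (_ : (fun mu => _) = (fun=> 0)); first exact: cst_continuous.
by apply/funext => mu; rewrite inner_term_entry (negPf ck).
Qed.

End Hessian.

(** * The Hessian at every parameter, and its primitive coefficients *)

(** The diagonal of w w^T consists of the squares of the entries of w. *)
Lemma rank_outer (K : fieldType) n (w : 'cV[K]_n) :
  w != 0 -> \rank (w *m w^T) = 1%N.
Proof.
move=> w0; apply/eqP; rewrite eqn_leq mulmx_max_rank /= lt0n mxrank_eq0.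
apply: contra_neq w0 => ww0; apply/matrixP => i j; rewrite ord1 mxE.
have /matrixP/(_ i i)/eqP := ww0; rewrite !mxE big_ord1 !mxE mulf_eq0 orbb.
by move/eqP.
Qed.

Section Coefficients.
Variables (R : realType) (r : nat) (L : zmodType).
Local Notation C := (Cplx R).
Variables (S : set L) (N : L -> int) (eta : 'I_r -> {additive L -> int}).
Hypotheses (hL : free_of_rank L r) (heta : dual_zbasis eta).
Hypothesis S0 : forall b, S b -> b != 0.

(** For a fixed c only finitely many k give a pole, and each of these misses a
punctured neighbourhood of lambda; there the off-pole Hessian agrees with the
resummed expression, which is continuous at lambda. *)
Lemma hessian_off_poles_cvg (lambda : C) c i j :
  hessian_off_poles eta S N mu c i j @[mu --> lambda^']
    --> (- formal_sum S (resummed_term eta N lambda) c) i j.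
Proof.
have [bs [ks [bs_uniq ks_uniq bsS ks0 support]]] :=
  divisor_support hL heta c S0.
have regular : \forall mu \near lambda^', regular_at S mu c.
  have : \forall mu \near lambda^', all (fun k => csin (k%:R * mu / 2) != 0) ks.
    elim: ks ks0 {ks_uniq support} => [|k ks IHks] ks0; first exact: nearW.
    have near_k := csin_neq0_near lambda (ks0 k (mem_head _ _)).
    have : {in ks, forall k', (0 < k')%N}.
      by move=> k' k'ks; rewrite ks0 // inE k'ks orbT.
    move=> /IHks.
    by move: near_k; apply: filterS2 => mu /= -> ->.
  apply: filterS => mu /allP mu_ks b k Sb k0 bk.
  exact: mu_ks (support b k Sb k0 bk).2.
have [G [G_cont GE]] : exists G : C -> C, continuous G /\
    forall mu, G mu = (- formal_sum S (resummed_term eta N mu) c) i j.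
  exists (fun mu => - (\sum_(b <- bs) (N b)%:~R *:
    \sum_(k <- ks) resummed_inner_term eta mu b k c) i j); split.
    move=> mu.
    exact: (cvgN (@continuous_resummed R L r eta N c bs ks i j mu)).
  move=> mu.
  by rewrite [RHS]mxE (resummedE eta N bs_uniq ks_uniq bsS ks0 support).
suff : hessian_off_poles eta S N mu c i j @[mu --> lambda^'] --> G lambda.
  by rewrite GE.
have /continuous_withinNx G_cvg := G_cont lambda.
apply: cvg_trans G_cvg; apply: near_eq_cvg.
move: regular; apply: filterS => mu mu_regular.
by rewrite GE (off_polesE eta N bs_uniq ks_uniq bsS ks0 support).
Qed.

Lemma hessianE (lambda : C) c :
  hessian eta S N lambda c = - formal_sum S (resummed_term eta N lambda) c.
Proof.
apply/matrixP => i j; rewrite mxE.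
apply: cvg_lim; first exact: norm_hausdorff.
exact: hessian_off_poles_cvg.
Qed.

(** If all the [eta_i b]_u vanish and u^2 <> 1, then the order of u^2 divides
every eta_i b, hence b itself, against primitivity. If u^2 = 1, they vanish only
with the integers eta_i b, which forces b = 0. *)
Lemma w_vec_neq0 (b : L) (u : C) : primitive b -> u != 0 ->
  exists i, qint (eta i b) u != 0.
Proof.
move=> b_prim u0; apply/existsP; rewrite -[X in is_true X]negbK; apply/negP.
move=> /existsPn w0.
have {}w0 i : qint (eta i b) u = 0 by apply/eqP; have := w0 i; rewrite negbK.
have [i bi] : exists i, eta i b != 0.
  apply/existsP; apply: contra_neqT b_prim.1 => /existsPn b0.
  apply: (dual_zbasis_separates hL heta) => i; apply/eqP.
  by have := b0 i; rewrite negbK.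
have [u2|u2] := eqVneq (u ^+ 2) 1.
  have /eqP := w0 i; rewrite qint_sqr1 // mulf_eq0 intr_eq0 (negPf bi) /=.
  by rewrite expfz_eq0 (negPf u0) andbF.
have bi_gt0 : (0 < `|eta i b|)%N by rewrite absz_gt0.
have [d d_prim _] := prim_order_exists bi_gt0 (qint_root_of_unity u0 (w0 i)).
have d1 : d = 1%N.
  apply: (primitive_dvd1 hL heta b_prim) => j.
  by rewrite dvdzE (prim_order_dvd d_prim) (qint_root_of_unity u0 (w0 j)).
by move: u2 (prim_expr_order d_prim); rewrite d1 expr1 => /eqP.
Qed.

(** A primitive b is a multiple k b' only for k = 1 and b' = b. *)
Lemma primitive_coefficient (lambda : C) b : S b -> primitive b ->
  - hessian eta S N lambda b
  = (N b)%:~R *: (w_vec eta b (u_ 1 lambda) *m (w_vec eta b (u_ 1 lambda))^T).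
Proof.
move=> Sb [_ b_prim]; rewrite hessianE opprK.
have mult1 b' k : b' *+ k = b -> k = 1%N /\ b' = b.
  by move=> bk; have k1 := b_prim b' k (esym bk); move: bk; rewrite k1.
have sup b' k : S b' -> (0 < k)%N -> b' *+ k = b ->
    b' \in [:: b] /\ k \in [:: 1%N].
  by move=> _ _ /mult1[-> ->]; rewrite !mem_seq1 !eqxx.
have inS : {in [:: b], forall b, S b} by move=> b'; rewrite mem_seq1 => /eqP ->.
have in1 : {in [:: 1%N], forall k, (0 < k)%N}.
  by move=> k; rewrite mem_seq1 => /eqP ->.
rewrite (@resummedE _ _ _ eta S N b [:: b] [:: 1%N]) // !big_seq1.
by rewrite /resummed_inner_term /qmonomial mulr1n eqxx invr1 scale1r.
Qed.

End Coefficients.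

Theorem theorem1p1 (R : realType) (r : nat) (L : zmodType)
    (hL : free_of_rank L r)
    (Lplus : set L) (hLplus : pointed_monoid Lplus)
    (S : set L) (hS : S `<=` [set b | Lplus b /\ b != 0])
    (N : L -> int)
    (eta : 'I_r -> {additive L -> int}) (heta : dual_zbasis eta) :
  (forall lambda : Cplx R,
     [/\ forall b, S b ->
           locally_finite [set k : nat | (0 < k)%N] (Phi_term b lambda),
         locally_finite S (potential_term N lambda),
         in_completion Lplus (potential S N lambda)
       & in_completion Lplus (hessian eta S N lambda)]) /\
  (forall (lambda : Cplx R) (c : L) (i j : 'I_r),
     hessian_off_poles eta S N mu c i j @[mu --> lambda^']
       --> hessian eta S N lambda c i j) /\
  (forall (lambda : Cplx R) (c : L), regular_at S lambda c ->
     hessian eta S N lambda c = hessian_off_poles eta S N lambda c) /\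
  (forall lambda : Cplx R,
     [/\ forall b, S b ->
           locally_finite [set k : nat | (0 < k)%N]
             (resummed_inner_term eta lambda b),
         locally_finite S (resummed_term eta N lambda)
       & forall c, hessian eta S N lambda c
           = - formal_sum S (resummed_term eta N lambda) c]) /\
  (forall b : L, S b -> primitive b -> forall lambda : Cplx R,
     - hessian eta S N lambda b
       = (N b)%:~R *: (w_vec eta b (u_ 1 lambda) *m (w_vec eta b (u_ 1 lambda))^T)
     /\ (N b != 0 -> \rank (- hessian eta S N lambda b) = 1%N)) /\
  (forall b : L, S b -> primitive b ->
     - classical_hessian R eta S N b
       = (N b)%:~R *: (v_vec R eta b *m (v_vec R eta b)^T)).
Proof.
have S0 b : S b -> b != 0 by move=> /hS[].
have S_multiple b k : S b -> Lplus (b *+ k).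
  case: hLplus => Lplus0 LplusD _ /hS[Lb _].
  by elim: k => // k IHk; rewrite mulrS; apply: LplusD.
have mult_finite (V : zmodType) (v : nat -> V) b : S b ->
    locally_finite [set k : nat | (0 < k)%N]
      (fun k => qmonomial (v k) (b *+ k)).
  move=> Sb c; have [bs [ks [_ _ _ _ support]]] := divisor_support hL heta c S0.
  apply: (@sub_finite_set _ _ [set` ks]); last exact: finite_seq.
  move=> k [k0 /qmonomial_neq0 ck].
  exact: (support b k Sb k0 (esym ck)).2.
(* Both the potential and its resummed Hessian are sums over S of scalar
   multiples of series supported on the positive multiples of one class. *)
have sum_finite (V : zmodType) (v : L -> nat -> V) (f : L -> L -> V) :
    (forall b c, f b c != 0 -> formal_sum [set k : nat | (0 < k)%N]
      (fun k => qmonomial (v b k) (b *+ k)) c != 0) -> locally_finite S f.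
  move=> fv c.
  have [bs [ks [bs_uniq ks_uniq bsS ks0 support]]] :=
  divisor_support hL heta c S0.
  apply: (@sub_finite_set _ _ [set` bs]); last exact: finite_seq.
  move=> b [Sb /fv]; apply: contraNT => bN.
  by rewrite (formal_sum_multiples0 ks_uniq ks0 support).
have sum_completion (V : zmodType) (v : L -> nat -> V) (f : L -> L -> V) :
    (forall b c, f b c != 0 -> formal_sum [set k : nat | (0 < k)%N]
      (fun k => qmonomial (v b k) (b *+ k)) c != 0) ->
    in_completion Lplus (formal_sum S f).
  move=> fv c; apply: contra_neqP => Lc; apply: fsbig1 => b Sb.
  apply/eqP; apply: contra_notT Lc => /fv; apply: contra_neqP => Lc.
  apply: fsbig1 => k _; apply/eqP; apply: contra_notT Lc => /qmonomial_neq0 ->.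
  exact: S_multiple.
have phiP (lambda : Cplx R) b c : potential_term N lambda b c != 0 ->
    formal_sum [set k : nat | (0 < k)%N] (Phi_term b lambda) c != 0.
  by apply: contra_neq => phi0; rewrite /potential_term /Phi phi0 mulr0.
have resP (lambda : Cplx R) b c : resummed_term eta N lambda b c != 0 ->
    formal_sum [set k : nat | (0 < k)%N] (resummed_inner_term eta lambda b) c
    != 0.
  by apply: contra_neq => res0; rewrite /resummed_term res0 scaler0.
have hessE (lambda : Cplx R) c := hessianE N hL heta S0 lambda c.
split; [|split; [|split; [|split; [|split]]]].
- move=> lambda; split.
  + by move=> b Sb; exact: mult_finite.
  + exact: (sum_finite _ _ _ (phiP lambda)).
  + exact: (sum_completion _ _ _ (phiP lambda)).
  + move=> c; rewrite hessE oppr_eq0.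
    exact: (sum_completion _ _ _ (resP lambda)).
- move=> lambda c i j; rewrite hessE.
  exact: hessian_off_poles_cvg.
- move=> lambda c c_regular; rewrite hessE.
  have [bs [ks [bs_uniq ks_uniq bsS ks0 support]]] :=
  divisor_support hL heta c S0.
  by rewrite (off_polesE eta N bs_uniq ks_uniq bsS ks0 support).
- move=> lambda; split; last exact: hessE.
  + by move=> b Sb; exact: mult_finite.
  + exact: (sum_finite _ _ _ (resP lambda)).
- move=> b Sb b_prim lambda.
  have coefE := primitive_coefficient N hL heta S0 lambda Sb b_prim.
  split=> // N0; rewrite coefE mxrank_scale_nz ?intr_eq0 // rank_outer //.
  have [i wi] := w_vec_neq0 hL heta b_prim (u_neq0 1 lambda).
  by move: wi; apply: contra_neq => /matrixP/(_ i ord0); rewrite !mxE.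
- move=> b Sb b_prim.
  rewrite /classical_hessian (primitive_coefficient N hL heta S0) //.
  have u1 : u_ 1 0 = 1 :> Cplx R by rewrite /u_ mulr0 mul0r cexp0.
  have -> : w_vec eta b (u_ 1 0) = v_vec R eta b; last by [].
  apply/matrixP => i j; rewrite !mxE u1 qint_sqr1 ?expr1n //.
  by rewrite exp1rz mulr1.
Qed.
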